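(* Let $\mu$ be a finite Borel measure on $\mathbb{R}$ that is continuous (has no atoms), and let $x\in\mathrm{supp}\,\mu$. Let $m>\varsigma\ge0$ be real numbers and assume that $$\limsup_{\epsilon\to0+}\epsilon^{-\varsigma}J_{\mu,m}(x,\epsilon)>0.$$ Then $$\gamma_\mu^-(x)\le\varsigma.$$
   Context: For $m>0$, $x\in\mathbb{R}$, $\epsilon>0$, the $m$-Borel transform of $\mu$ is $J_{\mu,m}(x,\epsilon)=\epsilon^m\int_{\mathbb{R}}\frac{d\mu(y)}{|x-y|^m+\epsilon^m}$. For $x\in\mathrm{supp}\,\mu$, $\gamma_\mu^-(x)=\liminf_{\epsilon\to0+}\frac{\log\mu([x-\epsilon,x+\epsilon])}{\log\epsilon}$. *)

(* Defs.v *)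
From HB Require Import structures.
From mathcomp Require Import all_boot all_order all_algebra.
From mathcomp Require Import all_classical all_reals all_analysis.
Import Order.TTheory GRing.Theory Num.Theory.
Import numFieldNormedType.Exports.

Set Implicit Arguments.
Unset Strict Implicit.
Unset Printing Implicit Defensive.

Local Open Scope classical_set_scope.
Local Open Scope ring_scope.

Section borel_transform.
Context {R : realType}.
(* The sigma-algebra of measurableTypeR R, generated by the intervals ]a, b],
   is the Borel sigma-algebra of R. *)
Variable mu : {finite_measure set (measurableTypeR R) -> \bar R}.

Definition atomless : Prop := forall y : R, mu [set y] = 0%E.

Definition measure_support : set R :=
  [set x | forall U : set R, open U -> U x -> (0 < mu U)%E].

Definition borel_transform (m x e : R) : \bar R :=
  ((e `^ m)%:E * \int[mu]_y (((`|x - y| `^ m + e `^ m)^-1)%:E))%E.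

(* The logarithm lne of the measure is extended-real valued, with
   lne 0 = -oo. *)
Definition lower_local_exponent (x : R) : \bar R :=
  limf_einf
    (fun e : R => (lne (mu `[(x - e)%R, (x + e)%R]%classic) / (ln e)%:E)%E) 0^'+.

End borel_transform.

(* Main.v *)
(* Suppose the lower exponent exceeds varsigma, and pick a with
   varsigma < a <= m such that mu [x - r, x + r] <= r ^ a for all small r.
   Put q = e ^ (1/n) and cut the line into the shells q^(k+1) < |x - y| <= q^k,
   for k <= n. On such a shell the kernel e^m / (|x - y|^m + e^m) is at most
   (q^n / q^(k+1)) ^ m, while the mass is O(q^(ka)); as a <= m, each of the n + 1
   shells contributes O(q^(na - m)) = O(e^(a - m/n)). When n is large enough
   that a - m/n > varsigma, e^(-varsigma) J(x, e) therefore tends to 0. *)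
Require Import Defs.
From HB Require Import structures.
From mathcomp Require Import all_boot all_order all_algebra.
From mathcomp Require Import all_classical all_reals all_analysis.
From mathcomp Require Import measurable_realfun ring.
Import Order.TTheory GRing.Theory Num.Theory.
Import numFieldNormedType.Exports.
Local Open Scope classical_set_scope.
Local Open Scope ring_scope.

(** The alternatives [k = 0] and [k = n] leave the outermost shell unbounded and let the innermost
    one reach the centre, so that every radius is covered. In the induction, [k] moves inwards only
    from the innermost shell. *)
Lemma geometric_shell {R : realFieldType} (q r : R) n :
  exists k, [/\ (k <= n)%N, k = 0%N \/ r <= q ^+ k & k = n \/ q ^+ k.+1 < r].
Proof.
elim: n => [|n [k [kn rk [kE|qr]]]]; first by exists 0%N; split=> //; left.
- subst k; have [rq|qr] := leP r (q ^+ n.+1).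
    by exists n.+1; split=> //; [right|left].
  by exists n; split=> //; right.
- by exists k; split=> //; [exact: leqW|right].
Qed.

(** The single term of the shell containing [r] already dominates; the others are nonnegative.
    Indicators of full balls replace those of shells, so that integration yields masses of
    intervals. *)
Lemma kernel_le_shell_sum {R : realType} (q r m : R) n :
  0 < q <= 1 -> 0 < m -> 0 <= r ->
  (q ^+ n) `^ m / (r `^ m + (q ^+ n) `^ m) <=
  \sum_(k < n.+1) (q ^+ n / q ^+ k.+1) `^ m *
    ((k == 0 :> nat) || (r <= q ^+ k))%:R.
Proof.
move=> /andP[q0 q1] m0 r0.
have qk0 k : 0 < q ^+ k by rewrite exprn_gt0.
have [k [kn rk qr]] := geometric_shell q r n.
have kn' : (k < n.+1)%N by [].
rewrite (bigD1 (Ordinal kn')) //=.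
have -> : (k == 0) || (r <= q ^+ k) by case: rk => [->|->] //; rewrite orbT.
rewrite mulr1 ler_wpDr //.
  by apply: sumr_ge0 => i _; rewrite mulr_ge0 ?powR_ge0 ?ler0n.
have den : 0 < r `^ m + (q ^+ n) `^ m by rewrite ltr_wpDl ?powR_ge0 ?powR_gt0.
rewrite ler_pdivrMr //; case: qr => [->|qr].
(* In the innermost shell [r] may vanish: the kernel is at most 1, and the coefficient is
   [(1 / q) ^ m >= 1]. *)
- rewrite -[leLHS]mul1r ler_pM ?powR_ge0 ?lerDr ?powR_ge0 //.
  have -> : 1 = 1 `^ m :> R by rewrite powR1.
  rewrite ge0_ler_powR ?(ltW m0) ?nnegrE //.
    by rewrite divr_ge0 // ltW.
  by rewrite ler_pdivlMr // mul1r exprS ler_piMl // ltW.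
(* Elsewhere the summand [r ^ m] of the denominator suffices, since [q ^ k.+1 < r]. *)
- rewrite mulrDr ler_wpDr ?mulr_ge0 ?powR_ge0 //.
  rewrite -powRM ?divr_ge0 ?(ltW (qk0 _)) //.
  rewrite ge0_ler_powR ?(ltW m0) ?nnegrE ?mulr_ge0 ?invr_ge0 ?(ltW (qk0 _)) //.
  by rewrite mulrAC ler_pdivlMr // ler_pM2l // ltW.
Qed.

Lemma measurable_cauchy_kernel {R : realType} (m x e : R) :
  measurable_fun [set: measurableTypeR R]
    (fun y => (`|x - y| `^ m + e `^ m)^-1 : measurableTypeR R).
Proof.
rewrite (_ : (fun _ => _) = (fun z : R => z `^ (-1)) \o
  (fun y => `|x - y| `^ m + e `^ m)); last first.
  by apply/funext => y /=; rewrite powR_inv1 // addr_ge0 ?powR_ge0.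
apply: measurableT_comp; first exact: measurable_powR.
apply: measurable_funD => //.
apply: (measurableT_comp (measurable_powR m)).
apply: measurableT_comp => //.
exact: measurable_funB.
Qed.

(* The scale k = 0 stands for the whole line, hence the bound C on the total
   mass. *)
Lemma borel_transform_le {R : realType}
    (mu : {finite_measure set (measurableTypeR R) -> \bar R})
    (m x q a C : R) (n : nat) :
  0 < q <= 1 -> 0 < m -> a <= m -> 0 <= C ->
  (mu setT <= C%:E)%E ->
  (forall k, (0 < k <= n)%N ->
    (mu `[(x - q ^+ k)%R, (x + q ^+ k)%R]%classic <= (C * (q ^+ k) `^ a)%:E)%E) ->
  (borel_transform mu m x (q ^+ n) <=
    (n.+1%:R * (C * q `^ (n%:R * a - m)))%:E)%E.
Proof.
move=> /andP[q0 q1] m0 am C0 muT muB.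
pose A k : set (measurableTypeR R) :=
  if k is 0 then setT else `[x - q ^+ k, x + q ^+ k]%classic.
have mA k : measurable (A k).
  by case: k => [|k]; [exact: measurableT | exact: measurable_itv].
have muA k : (k <= n)%N -> (mu (A k) <= (C * (q ^+ k) `^ a)%:E)%E.
  case: k => [|k] kn; last exact: muB.
  by rewrite expr0 powR1 mulr1.
have AE k y : (y \in A k) = (k == 0%N) || (`|x - y| <= q ^+ k).
  case: k => [|k]; first by rewrite in_setT.
  by rewrite /A mem_setE in_itv /= distrC ler_distl.
have qn0 : 0 < q ^+ n by rewrite exprn_gt0.
pose c k := (q ^+ n / q ^+ k.+1) `^ m.
rewrite /borel_transform -ge0_integralZl_EFin ?powR_ge0 //; first last.
- by apply/measurable_EFinP; exact: measurable_cauchy_kernel.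
- by move=> y _; rewrite lee_fin invr_ge0 addr_ge0 ?powR_ge0.
apply: (@le_trans _ _
  (\int[mu]_y \sum_(k < n.+1) (c k)%:E * (\1_(A k) y)%:E)%E).
  apply: ge0_le_integral => //.
  - move=> y _; rewrite -EFinM lee_fin mulr_ge0 ?powR_ge0 //.
    by rewrite invr_ge0 addr_ge0 ?powR_ge0.
  - apply: measurable_funeM; apply/measurable_EFinP.
    exact: measurable_cauchy_kernel.
  - apply: emeasurable_sum => k; apply: measurable_funeM.
    by apply/measurable_EFinP; exact: measurable_indic.
  - move=> y _; under eq_bigr do rewrite -EFinM indicE AE.
    rewrite sumEFin -EFinM lee_fin.
    by apply: kernel_le_shell_sum => //; rewrite q0.
rewrite ge0_integral_sum //; first last.
- by move=> k y _; rewrite -EFinM lee_fin mulr_ge0 ?powR_ge0.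
- move=> k; apply: measurable_funeM.
  by apply/measurable_EFinP; exact: measurable_indic.
rewrite -[n.+1 in leRHS]card_ord mulr_natl -sumr_const -sumEFin.
apply: lee_sum => k _.
rewrite ge0_integralZl_EFin ?powR_ge0 //; last first.
  by apply/measurable_EFinP; exact: measurable_indic.
rewrite integral_indic // setIT.
have kn : (k <= n)%N by rewrite -ltnS.
apply: (@le_trans _ _ ((c k)%:E * (C * (q ^+ k) `^ a)%:E)%E).
  by rewrite lee_pmul2l ?lte_fin ?powR_gt0 ?divr_gt0 ?exprn_gt0 ?muA.
rewrite -EFinM lee_fin mulrCA ler_wpM2l //.
(* Both sides become powers of [q <= 1], so it remains to compare exponents; they differ by
   [(n - k) * (m - a) >= 0]. *)
rewrite /c -!powR_mulrn ?(ltW q0) // -powRB; last by rewrite (gt_eqF q0) implybT.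
rewrite -!powRrM -powRD; last by rewrite (gt_eqF q0) implybT.
apply: ger_powR; first by rewrite q0.
rewrite -subr_ge0.
have -> : (n%:R - k.+1%:R) * m + k%:R * a - (n%:R * a - m)
  = (n%:R - k%:R) * (m - a) :> R by rewrite -natr1; ring.
by rewrite mulr_ge0 ?subr_ge0 ?ler_nat.
Qed.

Lemma limf_einf_gt {T : choiceType} {X : filteredType T} {R : realType}
    (f : X -> \bar R) (F : set_system X) (b : \bar R) :
  Filter F -> (b < limf_einf f F)%E ->
  exists2 c, (b < c)%E & \forall e \near F, (c <= f e)%E.
Proof.
move=> FF; rewrite limf_einfE => /ereal_sup_gt[_ [V FV <-] bV].
exists (ereal_inf (f @` V)) => //.
by apply: filterS FV => e Ve; apply: ereal_inf_lbound; exists e.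
Qed.

Lemma limf_esup_le {T : choiceType} {X : filteredType T} {R : realType}
    (f : X -> \bar R) (F : set_system X) (c : \bar R) :
  (\forall e \near F, (f e <= c)%E) -> (limf_esup f F <= c)%E.
Proof.
move=> fc; rewrite limf_esupE; apply: ge_ereal_inf.
exists (ereal_sup (f @` [set e | (f e <= c)%E])).
  by exists [set e | (f e <= c)%E].
by apply: ge_ereal_sup => _ [e fec <-].
Qed.

Lemma le_powR_of_le_lne_div {R : realType} (t : \bar R) (a e : R) :
  0 < e < 1 -> t \is a fin_num -> (a%:E <= lne t / (ln e)%:E)%E ->
  (t <= (e `^ a)%:E)%E.
Proof.
move=> /andP[e0 e1]; case: t => // t _.
have lne0 : ln e < 0 by rewrite ln_lt0 // e0.
(* Zero mass is treated apart because [lne 0 = -oo]. For positive mass, multiplying by [ln e < 0]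
   reverses the inequality. *)
have [t0|t0] := leP t 0.
  by move=> _; rewrite lee_fin (le_trans t0) ?powR_ge0.
rewrite lne_EFin // inver lt_eqF // lee_ndivlMr // -EFinM !lee_fin => h.
by rewrite -ler_ln ?posrE ?powR_gt0 // ln_powR.
Qed.

Theorem theorem1p8 (R : realType)
    (mu : {finite_measure set (measurableTypeR R) -> \bar R})
    (mu_cont : atomless mu)
    (x : R) (x_supp : measure_support mu x)
    (m varsigma : R) (varsigma_ge0 : 0 <= varsigma) (lt_varsigma_m : varsigma < m)
    (J_gt0 : (0 < limf_esup
        (fun e : R => (e `^ (- varsigma))%:E * borel_transform mu m x e) 0^'+)%E) :
  (lower_local_exponent mu x <= varsigma%:E)%E.
Proof.
rewrite leNgt; apply/negP => /limf_einf_gt[c sc muc].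
move: J_gt0; rewrite ltNge => /negP; apply.
have m0 : 0 < m := le_lt_trans varsigma_ge0 lt_varsigma_m.
(* The exponent is capped at [m], as the shell estimate requires; this also yields a real [a] when
   [c] is infinite. *)
have [a [sa am ac]] : exists a, [/\ varsigma < a, a <= m & (a%:E <= c)%E].
  case: c sc {muc} => [c| |] //; rewrite ?lte_fin => sc.
  - exists (Num.min c m).
    by rewrite lt_min sc lt_varsigma_m lee_fin !ge_min !lexx orbT.
  - by exists m; rewrite lt_varsigma_m lexx leey.
have [d [d0 d1 dmu]] : exists d, [/\ 0 < d, d <= 1 & forall e, 0 < e < d ->
    (mu `[(x - e)%R, (x + e)%R]%classic <= (e `^ a)%:E)%E].
  have [d /= d0 dmu] := muc.
  (* Radii below 1 have a negative logarithm. *)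
  exists (Num.min d 1); split; rewrite ?lt_min ?d0 ?ltr01 ?ge_min ?lexx ?orbT //.
  move=> e; rewrite lt_min => /and3P[e0 ed e1].
  apply: le_powR_of_le_lne_div; rewrite ?e0 //.
    exact: fin_num_measure.
  apply: (le_trans ac); apply: dmu => //=.
  by rewrite sub0r normrN gtr0_norm.
(* This constant bounds the total mass, and being at least 1 it may also multiply the bounds on
   small balls. *)
pose C := 1 + fine (mu setT).
have muT : mu setT \is a fin_num by exact: fin_num_measure.
have C1 : 1 <= C by rewrite lerDl fine_ge0.
have C0 : 0 <= C := le_trans ler01 C1.
(* This choice makes the loss [m / n] smaller than [a - varsigma], hence [kappa > 0]. *)
pose n := Num.bound (m / (a - varsigma)).
have as0 : 0 < a - varsigma by rewrite subr_gt0.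
have nm : m / (a - varsigma) < n%:R
  by apply: archi_boundP; rewrite divr_ge0 // ltW.
have n0 : 0 < n%:R :> R by apply: le_lt_trans nm; rewrite divr_ge0 // ltW.
pose kappa := a - m / n%:R - varsigma.
have kappa0 : 0 < kappa.
  rewrite /kappa addrAC subr_gt0 ltr_pdivrMr // mulrC -ltr_pdivrMr //.
have Jle : \forall e \near 0^'+,
    ((e `^ (- varsigma))%:E * borel_transform mu m x e <=
      (n.+1%:R * C * e `^ kappa)%:E)%E.
  near=> e.
  have e0 : 0 < e by near: e; exact: nbhs_right_gt.
  pose q := e `^ n%:R^-1.
  have q0 : 0 < q by exact: powR_gt0.
  have qn : q ^+ n = e.
    by rewrite -powR_mulrn ?powR_ge0 // -powRrM mulVf ?gt_eqF // powRr1 // ltW.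
  (* All balls with [k >= 1] have radius at most [q], so the local mass bound applies to each once
     [q < d]. *)
  have qd : e `^ n%:R^-1 < d.
    near: e.
    have h : 0 < n%:R^-1 :> R by rewrite invr_gt0.
    exact: cvgr_lt _ (powR_cvg0 h) _ d0.
  have q1 : q <= 1 by rewrite (le_trans (ltW qd)).
  have := @borel_transform_le R mu m x q a C n.
  rewrite q0 q1 qn => /(_ isT m0 am C0) J.
  have eE : q `^ (n%:R * a - m) = e `^ (a - m / n%:R).
    rewrite -powRrM; congr (_ `^ _); rewrite mulrBr mulrA mulVf ?gt_eqF // mul1r.
    by rewrite [_ * m]mulrC.
  have -> : n.+1%:R * C * e `^ kappa
    = e `^ (- varsigma) * (n.+1%:R * (C * q `^ (n%:R * a - m))).
    rewrite /kappa [a - _ - _]addrC [e `^ (_ + _)]powRD; last first.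
      by rewrite (gt_eqF e0) implybT.
    by rewrite eE; ring.
  rewrite EFinM lee_pmul2l ?lte_fin ?powR_gt0 //.
  apply: J.
    by rewrite -[mu setT]fineK // lee_fin lerDr.
  move=> [//|k] kn.
  have qk : 0 < q ^+ k.+1 < d.
    rewrite exprn_gt0 //= (le_lt_trans _ qd) // exprS.
    by rewrite ler_piMr ?exprn_ile1 // ltW.
  apply: (le_trans (dmu _ qk)).
  by rewrite lee_fin ler_peMl ?powR_ge0.
(* As [e ^ kappa] tends to 0, the limsup is at most every [eta > 0]. *)
apply/lee_addgt0Pr => eta eta0; rewrite add0e; apply: limf_esup_le.
near=> e.
apply: (le_trans (near Jle e _)) => //.
rewrite lee_fin; near: e.
have h : n.+1%:R * C * e `^ kappa @[e --> 0^'+] --> (0 : R).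
  rewrite -[X in _ --> X](mulr0 (n.+1%:R * C)).
  by apply: cvgM; [exact: cvg_cst | exact: powR_cvg0].
exact: cvgr_le _ h _ eta0.
Unshelve. all: by end_near.
Qed.
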